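(* Let $k \geq 2$ be an integer, let $q=p^n$ be a prime power ($p$ prime, $n \ge 1$) with $q \equiv 1 \bmod 2k$ and $k \mid \frac{q-1}{p-1}$, and let $\mathcal{P}(q,k)=(V,E)$ be the generalized Paley graph of order $q$ with $k$-th powers (which may be connected or disconnected). Then the condensed Ricci curvature satisfies $$\Bbbk(x,y) = \frac{k}{q-1}\left(2 + \vert \nabla_{xy} \vert\right)$$ for any edge $xy \in E$.
   Context: For an integer $k\ge 2$ and a finite field $\mathbb{F}_q$ of order $q=p^n$ with $q \equiv 1 \bmod 2k$, let $(\mathbb{F}_q^{\times})^k=\{\alpha\in\mathbb{F}_q^\times \mid \alpha=\beta^k \text{ for some } \beta\in\mathbb{F}_q^\times\}$. The generalized Paley graph $\mathcal{P}(q,k)$ is the simple undirected graph with vertex set $\mathbb{F}_q$ in which $x,y$ are adjacent if and only if $x-y\in(\mathbb{F}_q^\times)^k$. (The congruence guarantees $q$ is odd and $-1\in(\mathbb{F}_q^\times)^k$.) For a vertex $v$ of a locally finite simple graph $G=(V,E)$, $\Gamma(v)=\{w\in V\mid vw\in E\}$, and for an edge $xy\in E$, $\nabla_{xy}=\Gamma(x)\cap\Gamma(y)$. Condensed Ricci curvature (the modification of Ollivier's coarse Ricci curvature due to Lin, Lu and Yau): let $G=(V,E)$ be a connected, locally finite, undirected, simple graph with shortest path distance $\rho$. For $x\in V$ and $0<\varepsilon\le 1$ let $m_x^\varepsilon$ be the probability measure on $V$ with $m_x^\varepsilon(x)=1-\varepsilon$, $m_x^\varepsilon(v)=\varepsilon/|\Gamma(x)|$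 for $v\in\Gamma(x)$, and $m_x^\varepsilon(v)=0$ otherwise. For finitely supported probability measures $\mu,\nu$ on $V$ let $W(\mu,\nu)=\inf_{\pi}\sum_{u,v\in V}\rho(u,v)\pi(u,v)$ be the $1$-Wasserstein (transport) distance, the infimum being over all couplings $\pi$ of $\mu$ and $\nu$. For distinct $x,y\in V$ put $\Bbbk_\varepsilon(x,y)=1-\dfrac{W(m_x^\varepsilon,m_y^\varepsilon)}{\rho(x,y)}$ and define the condensed Ricci curvature $\Bbbk(x,y)=\lim_{\varepsilon\to0^+}\dfrac{\Bbbk_\varepsilon(x,y)}{\varepsilon}$. If the graph is disconnected, the condensed Ricci curvature of an edge $xy$ is the one computed in the connected component containing that edge. *)

(* Defs.v *)
From mathcomp Require Import all_boot all_order all_fingroup all_algebra all_solvable all_field.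
From mathcomp Require Import boolp classical_sets reals topology normedtype.
Set Implicit Arguments.
Unset Strict Implicit.
Unset Printing Implicit Defensive.
Import Order.TTheory GRing.Theory Num.Theory.
Import numFieldNormedType.Exports.
Local Open Scope ring_scope.

(* A finite simple graph is an irreflexive symmetric [e : rel T] on a finType. *)

Definition neighbors (T : finType) (e : rel T) (x : T) : {set T} :=
  [set w | e x w].

Definition common_neighbors (T : finType) (e : rel T) (x y : T) : {set T} :=
  neighbors e x :&: neighbors e y.

(* Shortest path distance.  For y not reachable from x it takes the junk value
   #|T|, which never occurs in a connected graph (see gdistP). *)
Definition gdist (T : finType) (e : rel T) (x y : T) : nat :=
  find (fun d => [exists p : d.-tuple T, path e x p && (last x p == y)])
       (iota 0 #|T|).

Lemma gdistP (T : finType) (e : rel T) (x y : T) : connect e x y ->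
  (exists p : seq T, [/\ path e x p, last x p = y & size p = gdist e x y]) /\
  (forall p : seq T, path e x p -> last x p = y -> (gdist e x y <= size p)%N).
Proof.
move=> cxy; rewrite /gdist.
set P := fun d : nat => _.
have PP (p : seq T) : path e x p -> last x p = y -> P (size p).
  move=> ep lp; apply/existsP; exists (in_tuple p).
  by rewrite /= ep lp eqxx.
have [p [ep lp szp]] : exists p : seq T,
    [/\ path e x p, last x p = y & (size p < #|T|)%N].
  case/connectP: cxy => p ep lp; move: lp; case/shortenP: ep => p' ep' up' _ lp.
  by exists p'; split=> //; rewrite -[_.+1]/(size (x :: p')) -(card_uniqP up') max_card.
have hasP : has P (iota 0 #|T|).
  by apply/hasP; exists (size p); [rewrite mem_iota | exact: PP].
have findlt : (find P (iota 0 #|T|) < #|T|)%N.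
  by move: hasP; rewrite has_find size_iota.
split.
  have := nth_find 0%N hasP; rewrite nth_iota // add0n.
  case/existsP => t /andP[et /eqP lt]; exists t; split=> //.
  by rewrite size_tuple.
move=> s es ls; rewrite leqNgt; apply/negP => lts.
have := before_find 0%N lts; rewrite nth_iota ?add0n ?PP //.
exact: ltn_trans lts findlt.
Qed.

Section Curvature.
Variables (R : realType) (T : finType) (e : rel T).

Definition lazy_walk (eps : R) (x : T) : T -> R := fun v =>
  if v == x then 1 - eps
  else if v \in neighbors e x then eps / #|neighbors e x|%:R
  else 0.

Definition is_coupling (mu nu : T -> R) (pi : T -> T -> R) : Prop :=
  [/\ forall u v, 0 <= pi u v,
      forall u, \sum_(v : T) pi u v = mu u
    & forall v, \sum_(u : T) pi u v = nu v].

Definition transport_cost (pi : T -> T -> R) : R :=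
  \sum_(u : T) \sum_(v : T) (gdist e u v)%:R * pi u v.

Definition wasserstein (mu nu : T -> R) : R :=
  inf [set transport_cost pi | pi in [set pi | is_coupling mu nu pi]]%classic.

Definition ollivier_ricci (eps : R) (x y : T) : R :=
  1 - wasserstein (lazy_walk eps x) (lazy_walk eps y) / (gdist e x y)%:R.

Definition ricci_quotient (x y : T) : R -> R := fun eps =>
  ollivier_ricci eps x y / eps.

Definition condensed_ricci (x y : T) : R :=
  lim (ricci_quotient x y eps @[eps --> 0^'+])%classic.

End Curvature.

Section Component.
Variables (T : finType) (e : rel T).

Definition component (x : T) : finType := {z : T | connect e x z}.

Definition component_rel (x : T) : rel (component x) :=
  fun u v => e (val u) (val v).

Definition component_src (x : T) : component x := exist _ x (connect0 e x).

Definition component_tgt (x y : T) (exy : e x y) : component x :=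
  exist _ y (connect1 exy).

Lemma component_connected (x : T) (u v : component x) :
  symmetric e -> connect (@component_rel x) u v.
Proof.
move=> esym.
have rsym : connect_sym (@component_rel x).
  by apply: sym_connect_sym => a b; rewrite /component_rel esym.
suff H w : connect (@component_rel x) (component_src x) w.
  by apply: connect_trans (H v); rewrite rsym.
case: w => z cz.
have /connectP[p ep lp] := cz.
elim/last_ind: p z cz ep lp => [|p a IH] z cz /=.
  by move=> _ zx; rewrite (_ : exist _ z cz = component_src x) ?connect0 //;
     apply: val_inj.
rewrite rcons_path last_rcons => /andP[ep ea] za; subst z.
have cp : connect e x (last x p) by apply/connectP; exists p.
by apply: connect_trans (IH _ cp ep erefl) _; apply: connect1.
Qed.

End Component.

(* The quotient whose limit at 0+ is the curvature of the edge xy, and that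
   curvature, both taken in the connected component containing the edge. *)
Definition edge_ricci_quotient (R : realType) (T : finType) (e : rel T)
    (x y : T) (exy : e x y) : R -> R :=
  ricci_quotient (@component_rel T e x) (component_src e x) (component_tgt exy).

Definition edge_condensed_ricci (R : realType) (T : finType) (e : rel T)
    (x y : T) (exy : e x y) : R :=
  condensed_ricci R (@component_rel T e x)
    (component_src e x) (component_tgt exy).

Definition kth_powers (F : finFieldType) (k : nat) : {set F} :=
  [set b ^+ k | b in [set b : F | b != 0]].

Definition paley (F : finFieldType) (k : nat) : rel F :=
  fun x y => x - y \in kth_powers F k.

Lemma paley_irreflexive (F : finFieldType) (k : nat) : irreflexive (@paley F k).
Proof.
move=> x; rewrite /paley subrr; apply/negbTE/negP => /imsetP[b].
by rewrite inE => b0 /esym/eqP; rewrite expf_eq0 (negPf b0) andbF.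
Qed.

Lemma opp1_kth_power (F : finFieldType) (k : nat) :
  (2 <= k)%N -> #|F| = 1 %[mod 2 * k] -> -1 \in kth_powers F k.
Proof.
move=> k2 Fk.
have F1 : (1 < #|F|)%N by exact: finNzRing_gt1.
have /dvdnP[m Em] : (2 * k %| #|F|.-1)%N.
  by rewrite -subn1 -eqn_mod_dvd ?(ltnW F1) //; apply/eqP.
have m0 : (0 < m)%N by case: m Em => //; rewrite mul0n; case: #|F| F1 => [|[]].
have /cyclicP[g Eg] := field_unit_group_cyclic [set: {unit F}]%G.
have og : #[g]%g = #|F|.-1 by rewrite /order -Eg -card_finField_unit.
apply/imsetP; exists (val g ^+ m).
  by rewrite inE -unitfE unitrX // (valP g).
have km0 : (0 < m * k)%N by rewrite muln_gt0 m0 (ltnW k2).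
have gX n : val g ^+ n = val (g ^+ n)%g by rewrite FinRing.val_unitX.
rewrite -exprM; apply/eqP; rewrite eq_sym.
have : (val g ^+ (m * k)) ^+ 2 == 1.
  rewrite -exprM -mulnA (mulnC k) -Em -og gX expg_order.
  by rewrite FinRing.val_unit1.
rewrite sqrf_eq1 => /orP[/eqP g1|//].
have : (g ^+ (m * k))%g == 1%g by rewrite -val_eqE /= -gX g1.
rewrite -order_dvdn og Em => /(dvdn_leq km0).
by rewrite (mulnC 2%N) mulnA muln2 -addnn -{3}(addn0 (m * k)%N) leq_add2l leqNgt km0.
Qed.

Lemma paley_symmetric (F : finFieldType) (k : nat) :
  (2 <= k)%N -> #|F| = 1 %[mod 2 * k] -> symmetric (@paley F k).
Proof.
move=> k2 Fk.
suff H : forall x y : F, paley k x y -> paley k y x by move=> x y; apply/idP/idP; exact: H.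
have /imsetP[c] := opp1_kth_power k2 Fk. rewrite inE => c0 Ec.
move=> x y; rewrite /paley; case/imsetP => b; rewrite inE => b0 Eb; apply/imsetP; exists (c * b).
  by rewrite inE mulf_neq0.
by rewrite exprMn -Ec -Eb mulN1r opprB.
Qed.

(* Main.v *)
Require Import Defs.
From mathcomp Require Import all_boot all_order all_algebra all_field.
From mathcomp Require Import classical_sets reals topology normedtype.
From mathcomp Require Import all_solvable ring lra.
Import Order.TTheory GRing.Theory Num.Theory.
Import numFieldNormedType.Exports.
Local Open Scope ring_scope.

(** Since [k] divides [(q - 1) / (p - 1)], every element of the prime field
    other than [0] is a [k]-th power, so each coset of the scaled prime field
    [(x - y) F_p] is a clique.  Translation by [y - x] is a graph automorphism
    sending [x] to [y] that preserves each of these cosets; hence the lazy walks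
    at [x] and at [y] give the same mass to each coset, and all the mass to be
    moved can travel along single edges.  The transport distance is therefore
    the total variation distance, which for [d]-regular graphs and small [eps]
    is [1 - (2 + |common neighbours|) eps / d], where here [d = (q - 1) / k]. *)

(** * Shortest-path distance of equal, distinct and adjacent vertices *)

Section GraphDistance.
Variables (T : finType) (e : rel T).

Lemma gdistxx (x : T) : gdist e x x = 0%N.
Proof.
have [_ /(_ [::] isT erefl)] := gdistP (connect0 e x).
by rewrite leqn0 => /eqP.
Qed.

(** Only the empty path has length 0, and it ends where it starts. Connectivity is irrelevant
    because the junk value [#|T|] is positive. *)
Lemma gdist_gt0 (x y : T) : x != y -> (0 < gdist e x y)%N.
Proof.
move=> xy; rewrite lt0n; apply/eqP => d0.
have T0 : (0 < #|T|)%N by apply/card_gt0P; exists x.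
have := @nth_find _ 0%N
  (fun d => [exists p : d.-tuple T, path e x p && (last x p == y)]) (iota 0 #|T|).
rewrite has_find -/(gdist e x y) d0 size_iota T0 nth_iota // => /(_ isT).
by case/existsP=> p; rewrite tuple0 /= (negPf xy).
Qed.

Lemma gdist_edge (x y : T) : x != y -> e x y -> gdist e x y = 1%N.
Proof.
move=> xy exy; apply/eqP; rewrite eqn_leq gdist_gt0 // andbT.
by have [_ /(_ [:: y])] := gdistP (connect1 exy); apply; rewrite //= exy.
Qed.

End GraphDistance.

(** * Transport distance and total variation *)

Section Wasserstein.
Variables (R : realType) (T : finType) (e : rel T) (mu nu : T -> R).
Hypotheses (mu_ge0 : forall u, 0 <= mu u) (nu_ge0 : forall u, 0 <= nu u).
Hypothesis mu1 : \sum_u mu u = 1.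

Let common (u : T) : R := Num.min (mu u) (nu u).

(** A coupling leaves at most [common u] in place at [u]; the remaining mass travels a distance of
    at least 1. *)
Lemma transport_cost_ge (pi : T -> T -> R) : is_coupling mu nu pi ->
  1 - \sum_u common u <= transport_cost e pi.
Proof.
case=> pi0 pimu pinu.
rewrite -mu1 -sumrB /transport_cost; apply: ler_sum => u _.
rewrite (bigD1 u) //= gdistxx mul0r add0r.
have -> : mu u = pi u u + \sum_(v | v != u) pi u v by rewrite -pimu (bigD1 u).
have piu : pi u u <= common u.
  rewrite le_min -{1}pimu -{1}pinu (bigD1 u) //= (bigD1 (F := fun w => pi w u) u) //=.
  by rewrite !lerDl !sumr_ge0.
have : \sum_(v | v != u) pi u v <= \sum_(v | v != u) (gdist e u v)%:R * pi u v.
  apply: ler_sum => v vu; rewrite -[leLHS]mul1r ler_wpM2r //.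
  by rewrite ler1n gdist_gt0 // eq_sym.
by move: piu; lra.
Qed.

Variables (I : eqType) (f : T -> I).
Hypothesis clique : forall u v, u != v -> f u = f v -> e u v.
Hypothesis mass : forall i, \sum_(u | f u == i) mu u = \sum_(u | f u == i) nu u.

Let excess (u : T) := mu u - common u.
Let deficit (u : T) := nu u - common u.
Let moved (i : I) := \sum_(u | f u == i) excess u.
(** The common mass stays put. Within each fibre of [f], the excess of [mu] is spread over the
    deficits of [nu] in proportion to their size, as in a product coupling normalised by the mass to
    be moved. *)
Let plan (u v : T) : R :=
  (if u == v then common u else 0) +
  (if f u == f v then excess u * deficit v / moved (f u) else 0).

Let excess_ge0 u : 0 <= excess u.
Proof. by rewrite subr_ge0 ge_min lexx. Qed.

Let deficit_ge0 u : 0 <= deficit u.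
Proof. by rewrite subr_ge0 ge_min lexx orbT. Qed.

Let moved_deficit i : \sum_(u | f u == i) deficit u = moved i.
Proof. by rewrite /moved !sumrB mass. Qed.

(** If [moved (f u)] is 0, the nonnegative excesses that sum to it all vanish, so division by zero
    does no harm. *)
Let excess_moved u : excess u * moved (f u) / moved (f u) = excess u.
Proof.
have [m0|m0] := eqVneq (moved (f u)) 0; last by rewrite mulfK.
rewrite m0 mulr0 mul0r; apply/esym/eqP; move/eqP: m0.
by rewrite psumr_eq0 // => /allP /(_ u (mem_index_enum u)); rewrite eqxx.
Qed.

Let deficit_moved u : deficit u * moved (f u) / moved (f u) = deficit u.
Proof.
have [m0|m0] := eqVneq (moved (f u)) 0; last by rewrite mulfK.
rewrite m0 mulr0 mul0r; apply/esym/eqP; move/eqP: m0; rewrite -moved_deficit.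
by rewrite psumr_eq0 // => /allP /(_ u (mem_index_enum u)); rewrite eqxx.
Qed.

Let sum_excess u :
  \sum_v (if f u == f v then excess u * deficit v / moved (f u) else 0) = excess u.
Proof.
rewrite -big_mkcond /= -[RHS]excess_moved -moved_deficit.
rewrite -mulrA mulr_suml mulr_sumr; apply: eq_big => [v|v _]; first exact: eq_sym.
by rewrite mulrA.
Qed.

Let plan_coupling : is_coupling mu nu plan.
Proof.
split=> [u v|u|v].
- apply: addr_ge0; case: ifP => // _; first by rewrite le_min mu_ge0 nu_ge0.
  by rewrite divr_ge0 ?mulr_ge0 // sumr_ge0.
- rewrite big_split /= sum_excess -big_mkcond /=.
  rewrite (big_pred1 u) => [|v]; last exact: eq_sym.
  by rewrite /excess addrC subrK.
rewrite big_split /= -big_mkcond /= big_pred1_eq -big_mkcond /=.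
rewrite -[RHS](subrK (common v)) -/(deficit v) [RHS]addrC; congr (_ + _).
rewrite -[RHS]deficit_moved {2}/moved -mulrA mulr_suml mulr_sumr.
by apply: eq_bigr => u /eqP ->; rewrite mulrA (mulrC (excess u)).
Qed.

Let plan_cost : transport_cost e plan = 1 - \sum_u common u.
Proof.
rewrite -mu1 -sumrB; apply: eq_bigr => u _.
rewrite -/(excess u) -[RHS]sum_excess; apply: eq_bigr => v _.
rewrite /plan; case: (eqVneq u v) => [<-|uv].
  (* No vertex has both an excess and a deficit, so the moving part of [plan] is zero on the
     diagonal. *)
  rewrite gdistxx mul0r eqxx /excess /deficit /common.
  by case: (leP (mu u) (nu u)); rewrite subrr ?mulr0 !mul0r.
by rewrite add0r; case: eqP => [fuv|]; rewrite ?mulr0 // gdist_edge ?mul1r // clique.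
Qed.

(* All the mass that has to move can be moved inside the cliques cut out by [f],
   so the transport distance is the total variation distance. *)
Lemma wasserstein_cliques :
  wasserstein e mu nu = 1 - \sum_u Num.min (mu u) (nu u).
Proof.
rewrite /wasserstein; set A := (X in inf X).
have lbA : lbound A (1 - \sum_u common u).
  by move=> _ [pi /= cpi <-]; exact: transport_cost_ge.
have memA : A (1 - \sum_u common u) by exists plan.
apply/le_anti/andP; split; first by apply: ge_inf => //; exists (1 - \sum_u common u).
by apply: lb_le_inf => //; exists (1 - \sum_u common u).
Qed.

End Wasserstein.

(** * Curvature of an edge in a graph with an automorphism preserving cliques *)

Section LazyWalk.
Variables (R : realType) (T : finType) (e : rel T).
Hypothesis eirr : irreflexive e.

Lemma lazy_walk_ge0 (eps : R) (x u : T) : 0 <= eps <= 1 -> 0 <= lazy_walk e eps x u.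
Proof.
case/andP=> e0 e1; rewrite /lazy_walk; case: ifP => _; first by rewrite subr_ge0.
by case: ifP => // _; rewrite divr_ge0.
Qed.

Lemma sum_lazy_walk (eps : R) (x : T) : (0 < #|neighbors e x|)%N ->
  \sum_u lazy_walk e eps x u = 1.
Proof.
move=> d0; rewrite (bigD1 x) //= {1}/lazy_walk eqxx.
have -> : \sum_(i | i != x) lazy_walk e eps x i =
          \sum_(i in neighbors e x) eps / #|neighbors e x|%:R.
  rewrite [RHS]big_mkcond [RHS](bigD1 x) //= inE eirr add0r.
  by apply: eq_bigr => u /negPf ux; rewrite /lazy_walk ux.
by rewrite sumr_const -[X in _ + X]mulr_natr divfK ?pnatr_eq0 -?lt0n // subrK.
Qed.

Hypothesis esym : symmetric e.
Variables (x y : T) (t : T -> T) (I : eqType) (f : T -> I).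
Hypothesis exy : e x y.
Hypothesis t_inj : injective t.
Hypothesis t_auto : forall u v, e (t u) (t v) = e u v.
Hypothesis t_xy : t x = y.
Hypothesis f_t : forall u, f (t u) = f u.
Hypothesis clique : forall u v, u != v -> f u = f v -> e u v.

Let d : nat := #|neighbors e x|.

Let d_gt0 : (0 < d)%N.
Proof. by apply/card_gt0P; exists y; rewrite inE. Qed.

Let neighbors_y : neighbors e y = t @: neighbors e x.
Proof.
have [t' tK t'K] := injF_bij t_inj.
apply/setP => u; rewrite inE -[u]t'K (mem_imset _ _ t_inj) inE.
by rewrite -{1}t_xy t_auto.
Qed.

Let d_y : #|neighbors e y| = d.
Proof. by rewrite neighbors_y card_imset. Qed.

Let lazy_walk_t (eps : R) (u : T) : lazy_walk e eps y (t u) = lazy_walk e eps x u.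
Proof.
rewrite /lazy_walk d_y -{1}t_xy (inj_eq t_inj).
by rewrite neighbors_y (mem_imset _ _ t_inj).
Qed.

(** The bound on [eps] makes the minimum at [x] and at [y] the neighbour mass [eps / d]. Each common
    neighbour contributes the same amount, and at any other vertex one of the two walks has no
    mass. *)
Lemma sum_min_lazy_walk (eps : R) : 0 <= eps -> eps / d%:R <= 1 - eps ->
  \sum_u Num.min (lazy_walk e eps x u) (lazy_walk e eps y u) =
    eps / d%:R * (2 + #|common_neighbors e x y|%:R).
Proof.
move=> e0 small.
have xy : x != y by apply/eqP => xy; have := eirr x; rewrite {2}xy exy.
have nn : 0 <= eps / d%:R by rewrite divr_ge0.
rewrite (bigD1 x) //= (bigD1 y) /= 1?eq_sym //.
have -> : Num.min (lazy_walk e eps x x) (lazy_walk e eps y x) = eps / d%:R.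
  by rewrite /lazy_walk eqxx (negPf xy) inE esym exy d_y min_r.
have -> : Num.min (lazy_walk e eps x y) (lazy_walk e eps y y) = eps / d%:R.
  by rewrite /lazy_walk eqxx eq_sym (negPf xy) inE exy min_l.
have -> : \sum_(i | (i != x) && (i != y))
    Num.min (lazy_walk e eps x i) (lazy_walk e eps y i) =
    \sum_(i in common_neighbors e x y) eps / d%:R.
  rewrite [RHS]big_mkcond [RHS](bigD1 x) //= [X in _ = _ + X](bigD1 y) /= 1?eq_sym //.
  rewrite !inE !eirr andbF /= !add0r; apply: eq_bigr => u /andP[/negPf ux /negPf uy].
  rewrite /lazy_walk ux uy d_y inE.
  by rewrite !inE -/d; case: (e x u); case: (e y u); rewrite /= ?minxx ?(min_l nn) ?(min_r nn).
by rewrite sumr_const -[eps / d%:R *+ _]mulr_natr; lra.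
Qed.

Lemma ollivier_ricci_cliques (eps : R) : 0 <= eps -> eps / d%:R <= 1 - eps ->
  ollivier_ricci e eps x y = eps / d%:R * (2 + #|common_neighbors e x y|%:R).
Proof.
move=> e0 small.
have e1 : 0 <= eps <= 1.
  by rewrite e0 -subr_ge0 (le_trans _ small) // divr_ge0.
have xy : x != y by apply/eqP => xy; have := eirr x; rewrite {2}xy exy.
rewrite /ollivier_ricci gdist_edge // divr1.
rewrite (@wasserstein_cliques _ _ _ _ _ _ _ _ _ f) //.
- by rewrite sum_min_lazy_walk // subKr.
- by move=> u; exact: lazy_walk_ge0.
- by move=> u; exact: lazy_walk_ge0.
- exact: sum_lazy_walk.
(* The map [t] carries the walk at [x] to the walk at [y] and preserves the fibres of [f], so both
   walks give each fibre equal mass. *)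
move=> i; rewrite [RHS](reindex_inj t_inj) /=.
by apply: eq_big => [u|u _]; rewrite ?f_t ?lazy_walk_t.
Qed.

Lemma near_ricci_quotient_cliques : \forall eps \near ((0 : R)^'+)%classic,
  ricci_quotient e x y eps = (2 + #|common_neighbors e x y|%:R) / d%:R.
Proof.
have d0 : (0 : R) < d%:R by rewrite ltr0n.
(* Below 1/2 the smallness condition holds, since [d >= 1] gives [eps / d <= eps < 1 - eps]. *)
have h0 : (0 : R) < 1 / 2 by lra.
near=> eps.
have e0 : 0 < eps by near: eps; exact: nbhs_right_gt.
have eh : eps < 1 / 2 by near: eps; exact: nbhs_right_lt.
rewrite /ricci_quotient ollivier_ricci_cliques ?(ltW e0) //.
  by rewrite mulrAC [eps / _]mulrC mulfK ?gt_eqF // mulrC.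
have : eps / d%:R <= eps.
  by rewrite ler_pdivrMr // ler_peMr ?(ltW e0) // ler1n.
by lra.
Unshelve. all: by end_near.
Qed.

End LazyWalk.

(** * Powers and the prime field inside a finite field *)

Section KthPowers.
Variables (F : finFieldType) (k m : nat).
Hypothesis Fkm : #|F|.-1 = (k * m)%N.

Let km_gt0 : (0 < k * m)%N.
Proof. by rewrite -Fkm -ltnS prednK ?finNzRing_gt1 // ltnW ?finNzRing_gt1. Qed.

Let unity_rootF (w : F) : w != 0 -> w ^+ (k * m) = 1.
Proof.
move=> w0; apply: (mulfI w0); rewrite -exprS -Fkm mulr1 prednK ?expf_card //.
by rewrite ltnW ?finNzRing_gt1.
Qed.

Lemma finField_prim_root : exists g : F, (k * m).-primitive_root g.
Proof.
pose s := enum [pred w : F | w != 0].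
suff /hasP[g _ g_prim] : has (k * m).-primitive_root s by exists g.
(* The nonzero elements are [k * m] distinct roots of unity of that order, which forces one of them
   to be primitive. *)
apply: has_prim_root => //; last 1 first.
- by rewrite -cardE -Fkm -(cardC1 (0 : F)).
- by apply/allP => w; rewrite mem_enum inE => /unity_rootF /unity_rootP.
- exact: enum_uniq.
Qed.

(** Take [h = g ^+ k] for a generator [g] of the multiplicative group: the [k]-th powers are then
    exactly the [m]-th roots of unity. *)
Let kth_powersP : exists2 h : F, m.-primitive_root h &
  kth_powers F k = [set h ^+ (i : nat) | i : 'I_m].
Proof.
have /andP[k0 m0] : (0 < k)%N && (0 < m)%N by rewrite -muln_gt0.
have [g g_prim] := finField_prim_root.
have gk_prim : m.-primitive_root (g ^+ k).
  by have := exp_prim_root g_prim k; rewrite gcdnMr mulKn.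
exists (g ^+ k) => //; apply/setP => w; apply/imsetP/imsetP => -[].
  move=> b; rewrite inE => b0 ->.
  have bk1 : (b ^+ k) ^+ m = 1 by rewrite -exprM unity_rootF.
  by have [i ->] := prim_rootP gk_prim bk1; exists i.
move=> i _ ->; exists (g ^+ i); last by rewrite -!exprM mulnC.
by rewrite inE expf_neq0 // (prim_root_eq0 g_prim) -lt0n.
Qed.

Lemma mem_kth_powers (w : F) : w ^+ m = 1 -> w \in kth_powers F k.
Proof.
have [h h_prim ->] := kth_powersP => /(prim_rootP h_prim)[i ->].
exact: imset_f.
Qed.

Lemma card_kth_powers : #|kth_powers F k| = m.
Proof.
have [h h_prim ->] := kth_powersP.
rewrite card_imset ?card_ord // => i j /eqP.
rewrite (eq_prim_root_expr h_prim) !modn_small // => /eqP.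
exact: val_inj.
Qed.

End KthPowers.

(** The map sending [a] to [a ^+ p - a] is additive with kernel the fixed points of Frobenius, so
    two elements of one fibre differ by a fixed point. *)
Lemma expr_pchar_sub_fixed (A : comNzRingType) (p : nat) (pA : p \in [pchar A])
    (a b : A) :
  pFrobenius_aut pA a - a = pFrobenius_aut pA b - b -> (a - b) ^+ p = a - b.
Proof.
move=> /(canRL (subrK _)) Ea.
by rewrite -(pFrobenius_autE pA) rmorphB /= Ea; ring.
Qed.

(** Here [w ^+ (p - 1) = 1], and the divisibility hypothesis makes [p - 1] divide [(q - 1) / k], so
    [w] is a root of unity of the order that characterises [k]-th powers. *)
Lemma prime_field_kth_powers (F : finFieldType) (p n k : nat) (w : F) :
  prime p -> #|F| = (p ^ n)%N -> (k %| (p ^ n - 1) %/ (p - 1))%N ->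
  w != 0 -> w ^+ p = w -> w \in kth_powers F k.
Proof.
move=> p_pr Fpn kdvd w0 wp.
have p0 := prime_gt0 p_pr.
have p1dvd : (p - 1 %| p ^ n - 1)%N.
  by rewrite -{2}(exp1n n) subn_exp dvdn_mulr.
have [c Ec] := dvdnP kdvd.
have Epn : #|F|.-1 = (k * (c * (p - 1)))%N.
  by rewrite mulnA (mulnC k) -Ec divnK // Fpn subn1.
apply: (mem_kth_powers _ _ _ Epn).
have wp1 : w ^+ (p - 1) = 1.
  by apply: (mulfI w0); rewrite -exprS mulr1 subn1 prednK.
by rewrite mulnC exprM wp1 expr1n.
Qed.

(** * Passing to a connected component *)

Section ComponentNeighbors.
Variables (T : finType) (e : rel T) (x y : T) (exy : e x y).

(** Since [B] lies in the component of [x], restricting to that component loses none of its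
    elements. *)
Let card_component (A : {set component e x}) (B : {set T}) :
  (forall u, (u \in A) = (val u \in B)) -> B \subset connect e x -> #|A| = #|B|.
Proof.
move=> AB /fintype.subsetP Bx; rewrite -(card_imset _ val_inj); apply: eq_card => w.
apply/imsetP/idP => [[u uA ->]|wB]; first by rewrite -AB.
by exists (exist _ w (Bx w wB)); rewrite // AB.
Qed.

Lemma card_component_neighbors :
  #|neighbors (@component_rel T e x) (component_src e x)| = #|neighbors e x|.
Proof.
apply: card_component => [u|]; first by rewrite !inE.
by apply/fintype.subsetP => w; rewrite inE => /connect1.
Qed.

Lemma card_component_common_neighbors :
  #|common_neighbors (@component_rel T e x)
      (component_src e x) (component_tgt exy)| = #|common_neighbors e x y|.
Proof.
apply: card_component => [u|]; first by rewrite !inE.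
by apply/fintype.subsetP => w; rewrite !inE => /andP[/connect1].
Qed.

End ComponentNeighbors.

(** * Curvature of the generalized Paley graph *)

Lemma paleyDr (F : finFieldType) (k : nat) (a x y : F) :
  paley k (x + a) (y + a) = paley k x y.
Proof. by rewrite /paley opprD addrACA subrr addr0. Qed.

Lemma card_neighbors_paley (F : finFieldType) (k : nat) (x : F) :
  #|neighbors (paley k) x| = #|kth_powers F k|.
Proof.
rewrite -[RHS](card_imset _ (inv_inj (subKr x))); apply: eq_card => w.
apply/idP/imsetP => [|[v vS ->]].
  by rewrite inE => xw; exists (x - w); rewrite ?subKr.
by rewrite inE /paley subKr.
Qed.

Theorem theorem1p11 (R : realType) (k p n : nat) (F : finFieldType)
    (hk : (2 <= k)%N) (hp : prime p) (hn : (1 <= n)%N)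
    (hF : #|F| = (p ^ n)%N)
    (hq : (p ^ n)%N = 1%N %[mod 2 * k])
    (hdvd : (k %| (p ^ n - 1) %/ (p - 1))%N)
    (x y : F) (exy : paley k x y) :
  cvg (edge_ricci_quotient (R := R) exy eps @[eps --> 0^'+])%classic /\
  edge_condensed_ricci R exy =
    k%:R / ((p ^ n)%:R - 1) * (2 + #|common_neighbors (paley k) x y|%:R).
Proof.
have Fk : #|F| = 1%N %[mod 2 * k] by rewrite hF.
have esym := paley_symmetric hk Fk.
have x_y : x - y != 0.
  by move: exy; rewrite /paley => /imsetP[b]; rewrite inE => b0 ->; rewrite expf_neq0.
have pF : p \in [pchar F] := card_finPcharP hF hp.
have shift_edge (u : F) : paley k u (u + (y - x)).
  by rewrite /paley opprD addNKr opprB.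
pose E := @component_rel F (paley k) x.
(* Every vertex is adjacent to its translate by [y - x], so the translation stays in the
   component. *)
pose shift (u : component (paley k) x) : component (paley k) x :=
  exist _ (val u + (y - x)) (connect_trans (valP u) (connect1 (shift_edge _))).
(* The fibres of [line] are the cosets of the prime field scaled by [x - y]. *)
pose line (u : component (paley k) x) : F :=
  pFrobenius_aut pF (val u / (x - y)) - val u / (x - y).
have near_q : \forall eps \near ((0 : R)^'+)%classic, edge_ricci_quotient exy eps =
    (2 + #|common_neighbors (paley k) x y|%:R) / #|kth_powers F k|%:R.
  rewrite -(card_component_common_neighbors _ _ _ _ exy) -(card_neighbors_paley _ _ x).
  rewrite -card_component_neighbors.
  apply: (@near_ricci_quotient_cliques _ _ E _ _ _ _ shift _ line).
  - by move=> u; exact: paley_irreflexive.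
  - by move=> u v; exact: esym.
  - exact: exy.
  - by move=> u v /(congr1 val) /= /addIr /val_inj.
  - by move=> u v; rewrite /E /component_rel /= paleyDr.
  - by apply: val_inj; rewrite /= addrC subrK.
  (* The translation changes [val u / (x - y)] by -1, which Frobenius fixes. *)
  - move=> u; rewrite /line /= mulrDl -(opprB x y) mulNr divff //.
    by rewrite rmorphB rmorph1 opprB addrA subrK.
  move=> u v uv; rewrite /line => fuv; rewrite /E /component_rel /paley.
  (* The scaled difference [w] is a nonzero fixed point of Frobenius, hence a [k]-th power; its
     product with the [k]-th power [x - y] is again one. *)
  set w := val u / (x - y) - val v / (x - y).
  have -> : val u - val v = w * (x - y) by rewrite mulrBl !divfK.
  have wp : w ^+ p = w := expr_pchar_sub_fixed _ _ pF _ _ fuv.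
  have w0 : w != 0.
    by rewrite -(mulIr_eq0 w (mulIf x_y)) mulrBl !divfK // subr_eq0.
  have /imsetP[a] := prime_field_kth_powers _ _ _ _ _ hp hF hdvd w0 wp.
  rewrite inE => a0 ->; have /imsetP[b] := exy; rewrite inE => b0 ->.
  by rewrite -exprMn; apply/imsetP; exists (a * b); rewrite // inE mulf_neq0.
have -> : k%:R / ((p ^ n)%:R - 1) * (2 + #|common_neighbors (paley k) x y|%:R) =
    (2 + #|common_neighbors (paley k) x y|%:R) / #|kth_powers F k|%:R :> R.
  have kF : (k %| #|F|.-1)%N.
    rewrite -subn1 -eqn_mod_dvd ?(ltnW (finNzRing_gt1 F)) //; apply/eqP.
    by rewrite -(modn_dvdm _ (dvdn_mull 2 (dvdnn k))) Fk modn_dvdm ?dvdn_mull.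
  rewrite -hF -(prednK (ltnW (finNzRing_gt1 F))) -natr1 addrK.
  have [m Em] := dvdnP kF; rewrite mulnC in Em.
  rewrite (card_kth_powers _ _ _ Em) Em natrM invfM mulrA divff ?mul1r 1?mulrC //.
  by rewrite pnatr_eq0 -lt0n ltnW.
(* The quotient is constant near 0 on the right, which yields both its convergence and its limit. *)
split; first exact: is_cvg_near_cst near_q.
exact: lim_near_cst near_q.
Qed.
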